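(* Let $\mathbb{F}$ be an algebraically closed field of arbitrary characteristic. Let $A$ be a $1$-perfect finite dimensional associative algebra over $\mathbb{F}$, let $A' \subseteq A$ be a subalgebra which is a perfect finite dimensional associative algebra, and let $(e',f')$ be a strict orthogonal idempotent pair in $A'$. Then there is a strict orthogonal idempotent pair $(e,f)$ in $A$ such that $e'A'f' \subseteq eAf$.
   Context: Associative algebras are not required to have an identity element, and subalgebras are not required to contain an identity of the larger algebra. An associative algebra $C$ is $1$-perfect if it has no (two-sided) ideals of codimension $1$, and perfect if $C^2=C$, i.e. $C$ is spanned by products of pairs of its elements. An idempotent pair $(e,f)$ in a finite dimensional associative algebra $C$ consists of idempotents $e,f\in C$ (possibly zero). It is orthogonal if $ef=fe=0$. It is strict if for each simple component $S$ of the semisimple algebra $\bar C = C/\operatorname{rad} C$ (where $\operatorname{rad} C$ is the nilpotent radical of $C$), the projections to $S$ of the images $\bar e, \bar f$ in $\bar C$ are either both zero or both non-zero. Strictness of a pair in the subalgebra $A'$ is with respect to $A'/\operatorname{rad} A'$. *)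

(* Defs.v *)
(* Finite dimensional associative algebras that need not have an identity.    *)
From HB Require Import structures.
From mathcomp Require Import all_boot all_order all_algebra.
From mathcomp Require Import boolp.

Set Implicit Arguments.
Unset Strict Implicit.
Unset Printing Implicit Defensive.

Import GRing.Theory.
Local Open Scope ring_scope.

(* mathcomp's algType and falgType are unital.  Here an algebra is a finite   *)
(* dimensional vector space with an associative bilinear product, written     *)
(* (x * y)%g because the product comes from semigroupType.                    *)
HB.mixin Record isBilinearMul (F : fieldType) C
    of Vector F C & Semigroup C := {
  amulDl : forall x y z : C, ((x + y) * z)%g = (x * z)%g + (y * z)%g;
  amulDr : forall x y z : C, (x * (y + z))%g = (x * y)%g + (x * z)%g;
  amulZl : forall (k : F) (x y : C), ((k *: x) * y)%g = k *: (x * y)%g;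
  amulZr : forall (k : F) (x y : C), (x * (k *: y))%g = k *: (x * y)%g
}.

#[short(type="assocAlgType")]
HB.structure Definition AssocAlg (F : fieldType) :=
  {C of isBilinearMul F C & Vector F C & Semigroup C}.

Section Product.

Context {F : fieldType} {C : assocAlgType F}.
Implicit Types (x y : C) (U V W : {vspace C}).

Lemma amul0 x : (x * 0)%g = 0.
Proof. by have := amulZr 0 x x; rewrite !scale0r. Qed.

Lemma amul_suml y n (f : 'I_n -> C) :
  ((\sum_i f i) * y)%g = \sum_i (f i * y)%g.
Proof.
apply: (big_morph (fun x => (x * y)%g) (fun u v => amulDl u v y)).
by have := amulZl 0 y y; rewrite !scale0r.
Qed.

Lemma amul_sumr x n (f : 'I_n -> C) :
  (x * (\sum_i f i))%g = \sum_i (x * f i)%g.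
Proof. exact: (big_morph _ (amulDr x) (amul0 x)). Qed.

(* The span of all products u * v with u in U and v in V: see aprodvP.        *)
Definition aprodv U V : {vspace C} :=
  <<[seq (u * v)%g | u <- vbasis U, v <- vbasis V]>>%VS.

Lemma memv_aprod U V : {in U & V, forall u v, (u * v)%g \in aprodv U V}.
Proof.
move=> u v /coord_vbasis-> /coord_vbasis->.
rewrite amul_suml; apply: memv_suml => i _.
rewrite amul_sumr; apply: memv_suml => j _.
rewrite amulZl amulZr !memvZ // memv_span //.
by apply/allpairsP; exists ((vbasis U)`_i, (vbasis V)`_j); rewrite !memt_nth.
Qed.

Lemma aprodvP U V W :
  reflect {in U & V, forall u v, (u * v)%g \in W} (aprodv U V <= W)%VS.
Proof.
apply: (iffP idP) => [sUVW u v Uu Vv | sUVW].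
  by rewrite (subvP sUVW) ?memv_aprod.
apply/span_subvP=> _ /allpairsP[[u v] /= [Uu Vv ->]].
by rewrite sUVW ?vbasis_mem.
Qed.

Lemma aprodvS U1 U2 V1 V2 :
  (U1 <= U2 -> V1 <= V2 -> aprodv U1 V1 <= aprodv U2 V2)%VS.
Proof.
move=> /subvP sU /subvP sV; apply/aprodvP=> u v Uu Vv.
by rewrite memv_aprod ?sU ?sV.
Qed.

(* apowv U n is the (n+1)-st power of U, so that no unit is needed.           *)
Definition apowv U n : {vspace C} := iter n (aprodv U) U.

Definition nilpotentv U : Prop := exists n, apowv U n = 0%VS.

Definition subalg_pred U : bool := (aprodv U U <= U)%VS.

Definition ideal_pred U : bool :=
  (aprodv fullv U <= U)%VS && (aprodv U fullv <= U)%VS.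

Lemma ideal_subalg U : ideal_pred U -> subalg_pred U.
Proof.
by case/andP=> + _; apply: subv_trans; apply: aprodvS (subvf U) (subvv U).
Qed.

End Product.

Record subalgebra (F : fieldType) (C : assocAlgType F) :=
  Subalgebra { subalg_vs :> {vspace C}; subalgP : subalg_pred subalg_vs }.

Record ideal (F : fieldType) (C : assocAlgType F) :=
  Ideal { ideal_vs :> {vspace C}; idealP : ideal_pred ideal_vs }.

Definition subalg_of_ideal (F : fieldType) (C : assocAlgType F) (I : ideal C) :=
  Subalgebra (ideal_subalg (idealP I)).

(* A subalgebra as an algebra in its own right.                               *)
Section SubalgType.

Context (F : fieldType) (C : assocAlgType F) (B : subalgebra C).

Definition subalg_type : Type := subvs_of B.
HB.instance Definition _ := Vector.on subalg_type.

Implicit Types x y z : subalg_type.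

Lemma submul_subproof x y : (vsval x * vsval y)%g \in (B : {vspace C}).
Proof. exact: (aprodvP _ _ _ (subalgP B)) (subvsP x) (subvsP y). Qed.

Definition submul x y : subalg_type := Subvs (submul_subproof x y).

Lemma submulA : associative submul.
Proof. by move=> x y z; apply/val_inj; rewrite /= mulgA. Qed.

HB.instance Definition _ := isSemigroup.Build subalg_type submulA.

Lemma submulDl x y z : ((x + y) * z)%g = (x * z)%g + (y * z)%g.
Proof. by apply/val_inj; rewrite /= amulDl. Qed.
Lemma submulDr x y z : (x * (y + z))%g = (x * y)%g + (x * z)%g.
Proof. by apply/val_inj; rewrite /= amulDr. Qed.
Lemma submulZl (k : F) x y : ((k *: x) * y)%g = k *: (x * y)%g.
Proof. by apply/val_inj; rewrite /= amulZl. Qed.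
Lemma submulZr (k : F) x y : (x * (k *: y))%g = k *: (x * y)%g.
Proof. by apply/val_inj; rewrite /= amulZr. Qed.

HB.instance Definition _ :=
  isBilinearMul.Build F subalg_type submulDl submulDr submulZl submulZr.

Definition subalg_val : subalg_type -> C := vsval.

Lemma subalg_valM x y : subalg_val (x * y)%g = (subalg_val x * subalg_val y)%g.
Proof. by []. Qed.

End SubalgType.

(* The quotient C / I: its carrier is a complement of I, onto which qpi I     *)
(* projects along I.  Lemmas qpiM, qpi_surj and qpi_eq0 characterise it.      *)
Section Quotient.

Context (F : fieldType) (C : assocAlgType F) (I : ideal C).

Definition aquot_type : Type := subvs_of (I^C)%VS.
HB.instance Definition _ := Vector.on aquot_type.

Definition qpi (x : C) : aquot_type := vsproj _ (daddv_pi (I^C)%VS I x).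

Lemma qpi_is_linear : linear qpi.
Proof. by move=> k x y; rewrite /qpi !linearP. Qed.

HB.instance Definition _ :=
  GRing.isSemilinear.Build F C aquot_type *:%R qpi
    (GRing.semilinear_linear qpi_is_linear).

Let cap0 : (I^C :&: I = 0)%VS.
Proof. by rewrite capvC capv_compl. Qed.

Let inD (x : C) : x \in (I^C + I)%VS.
Proof. by rewrite addvC addv_complf memvf. Qed.

Lemma vsval_qpi x : vsval (qpi x) = x - daddv_pi I (I^C)%VS x.
Proof.
rewrite /qpi vsprojK ?memv_pi //.
by rewrite -{2}(daddv_pi_add cap0 (inD x)) addrK.
Qed.

Lemma qpi_eq0 x : (qpi x == 0) = (x \in (I : {vspace C})).
Proof.
apply/eqP/idP => [/(congr1 vsval)/eqP | Ix].
  by rewrite vsval_qpi /= subr_eq0 => /eqP->; apply: memv_pi.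
apply/val_inj; have:= vsval_qpi x.
by rewrite daddv_pi_id ?subrr // capv_compl.
Qed.

Lemma qpiK : cancel (vsval : aquot_type -> C) qpi.
Proof.
move=> q; apply/val_inj; rewrite /= /qpi vsprojK ?memv_pi //.
by rewrite daddv_pi_id // subvsP.
Qed.

Lemma qpi_surj (q : aquot_type) : exists x, q = qpi x.
Proof. by exists (vsval q); rewrite qpiK. Qed.

Lemma ideal_mull (x y : C) :
  y \in (I : {vspace C}) -> (x * y)%g \in (I : {vspace C}).
Proof.
by case/andP: (idealP I) => + _ => /aprodvP; apply; rewrite ?memvf.
Qed.

Lemma ideal_mulr (x y : C) :
  x \in (I : {vspace C}) -> (x * y)%g \in (I : {vspace C}).
Proof.
by case/andP: (idealP I) => _ /aprodvP H Ix; apply: H; rewrite ?memvf.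
Qed.

Definition qmul (p q : aquot_type) : aquot_type := qpi (vsval p * vsval q)%g.

Lemma qmulE x y : qmul (qpi x) (qpi y) = qpi (x * y)%g.
Proof.
apply/eqP; rewrite -subr_eq0 -linearB qpi_eq0 !vsval_qpi.
set a := daddv_pi _ _ x; set b := daddv_pi _ _ y.
have -> : ((x - a) * (y - b))%g - (x * y)%g
          = - ((a * (y - b))%g + (x * b)%g).
  have -> : (x * y)%g = ((x - a) * (y - b))%g + (a * (y - b))%g + (x * b)%g.
    by rewrite -amulDl subrK -amulDr subrK.
  by rewrite -addrA opprD addrA subrr add0r.
rewrite rpredN; apply: memvD.
  exact: ideal_mulr (memv_pi _ _ _).
exact: ideal_mull (memv_pi _ _ _).
Qed.

Lemma qmulA : associative qmul.
Proof.
move=> p q r; have [x ->] := qpi_surj p; have [y ->] := qpi_surj q.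
have [z ->] := qpi_surj r; rewrite !qmulE.
by rewrite mulgA.
Qed.

HB.instance Definition _ := isSemigroup.Build aquot_type qmulA.

Lemma qpiM x y : qpi (x * y)%g = (qpi x * qpi y)%g.
Proof. by rewrite -qmulE. Qed.

Implicit Types p q r : aquot_type.

Lemma qmulDl p q r : ((p + q) * r)%g = (p * r)%g + (q * r)%g.
Proof. by rewrite -linearD /= -amulDl. Qed.
Lemma qmulDr p q r : (p * (q + r))%g = (p * q)%g + (p * r)%g.
Proof. by rewrite -linearD /= -amulDr. Qed.
Lemma qmulZl (k : F) p q : ((k *: p) * q)%g = k *: (p * q)%g.
Proof. by rewrite -linearZ /= -amulZl. Qed.
Lemma qmulZr (k : F) p q : (p * (k *: q))%g = k *: (p * q)%g.
Proof. by rewrite -linearZ /= -amulZr. Qed.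

HB.instance Definition _ :=
  isBilinearMul.Build F aquot_type qmulDl qmulDr qmulZl qmulZr.

End Quotient.

Section Nilradical.

Context (F : fieldType) (C : assocAlgType F).
Implicit Types I J K R U V W : {vspace C}.

Lemma aprodvA_sub U V W :
  (aprodv U (aprodv V W) <= aprodv (aprodv U V) W)%VS.
Proof.
apply/aprodvP=> u v Uu; rewrite {1}/aprodv.
set s := [seq _ | _ <- _, _ <- _] => /(@coord_span _ _ _ (in_tuple s)) ->.
rewrite amul_sumr; apply: memv_suml => i _; rewrite amulZr memvZ //.
have /allpairsP[[v1 w1] /= [Vv Ww ->]] : s`_i \in s by apply: mem_nth.
by rewrite mulgA !memv_aprod // vbasis_mem.
Qed.

Lemma apowvD_sub U m n :
  (apowv U (m.+1 + n) <= aprodv (apowv U m) (apowv U n))%VS.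
Proof.
elim: m => [|m IHm]; first exact: subvv.
by apply: subv_trans (aprodvA_sub _ _ _); apply: aprodvS (subvv U) IHm.
Qed.

Lemma ideal_predP I : reflect
  (forall x y, y \in I -> (x * y)%g \in I /\ (y * x)%g \in I) (ideal_pred I).
Proof.
apply: (iffP andP) => [[/aprodvP l /aprodvP r] x y Iy | H].
  by rewrite l ?r ?memvf.
split; apply/aprodvP=> x y Ix Iy; first by case: (H x y Iy).
by case: (H y x Ix).
Qed.

Lemma ideal_pred0 : ideal_pred (0%VS : {vspace C}).
Proof.
apply/ideal_predP=> x y; rewrite memv0 => /eqP->; rewrite amul0 mem0v.
by split=> //; have := amulZl 0 x x; rewrite !scale0r => ->; apply: mem0v.
Qed.

Lemma ideal_predD I J : ideal_pred I -> ideal_pred J -> ideal_pred (I + J)%VS.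
Proof.
move=> /ideal_predP idI /ideal_predP idJ; apply/ideal_predP=> x y.
case/memv_addP=> u /(idI x)[xu ux] [v /(idJ x)[xv vx] ->].
by rewrite amulDl amulDr; split; apply: memv_add.
Qed.

Lemma nilpotentvD I J : ideal_pred J ->
  nilpotentv I -> nilpotentv J -> nilpotentv (I + J)%VS.
Proof.
move=> /ideal_predP idJ [m I0] [n J0].
set K := (I + J)%VS.
have sKJ : (apowv K m <= J)%VS.
  rewrite -(add0v J) -I0; elim: {I0}m => [|m IHm]; first exact: subvv.
  apply/aprodvP=> _ v /memv_addP[i Ii [j Jj ->]].
  move/(subvP IHm)=> /memv_addP[p Ip [q Jq ->]].
  rewrite amulDr 2!amulDl -addrA; apply: memv_add; first exact: memv_aprod.
  have [iq _] := idJ i q Jq; have [jq _] := idJ j q Jq.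
  by rewrite !memvD //; case: (idJ p j Jj).
exists (n * m.+1 + m)%N; apply/eqP; rewrite -subv0 -J0.
elim: {J0}n => [|n IHn]; first exact: sKJ.
rewrite mulSn -addnA; apply: subv_trans (apowvD_sub _ _ _) _.
exact: aprodvS.
Qed.

Definition is_nilradical R : Prop :=
  [/\ ideal_pred R, nilpotentv R
    & forall I, ideal_pred I -> nilpotentv I -> (I <= R)%VS].

Lemma nilradical_exists : exists R, is_nilradical R.
Proof.
suff H n R : ideal_pred R -> nilpotentv R ->
    (\dim {:C} <= \dim R + n)%N -> exists R', is_nilradical R'.
  apply: (H (\dim {:C}) 0%VS); rewrite ?ideal_pred0 ?leq_addl //.
  by exists 0%N.
elim: n R => [|n IHn] R idR nilR leR.
all: have [maxR|] :=
  pselect (forall I, ideal_pred I -> nilpotentv I -> (I <= R)%VS);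
  first by exists R.
  case=> I _ _; suff -> : R = fullv by apply: subvf.
  by apply/eqP; rewrite eqEdim subvf -[leqRHS]addn0.
move=> /existsNP[I /not_implyP[idI /not_implyP[nilI /negP nsIR]]].
apply: (IHn (I + R)%VS); [exact: ideal_predD | exact: nilpotentvD |].
apply: leq_trans leR _; rewrite addnS -addSn leq_add2r.
rewrite ltn_neqAle dimvS ?addvSr // andbT.
apply: contraNneq nsIR => eqd.
have /eqP -> : R == (I + R)%VS by rewrite eqEdim addvSr eqd leqnn.
exact: addvSl.
Qed.

Definition nilradical_vs : {vspace C} := projT1 (cid nilradical_exists).

Lemma nilradical_vsP : is_nilradical nilradical_vs.
Proof. exact: projT2 (cid nilradical_exists). Qed.

Definition nilradical : ideal C :=
  Ideal (let: And3 idR _ _ := nilradical_vsP in idR).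

End Nilradical.

Definition one_perfect (F : fieldType) (C : assocAlgType F) : Prop :=
  forall I : ideal C, \dim {:C} <> (\dim I).+1.

Definition perfect (F : fieldType) (C : assocAlgType F) : Prop :=
  aprodv {:C} {:C} = fullv.

Definition simple_alg (F : fieldType) (C : assocAlgType F) : Prop :=
  aprodv {:C} {:C} <> 0%VS /\
  forall I : ideal C, (I : {vspace C}) = 0%VS \/ (I : {vspace C}) = fullv.

Definition idempotent_pair (F : fieldType) (C : assocAlgType F) (e f : C) :=
  (e * e)%g = e /\ (f * f)%g = f.

Definition orthogonal_pair (F : fieldType) (C : assocAlgType F) (e f : C) :=
  (e * f)%g = 0 /\ (f * e)%g = 0.

(* A simple component of the semisimple algebra C / rad C is an ideal S that  *)
(* is a simple algebra and a direct factor: C / rad C = S (+) T for an ideal  *)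
(* T, namely the sum of the other components.  The projection to S is the one *)
(* along T.                                                                   *)
Definition strict_pair (F : fieldType) (C : assocAlgType F) (e f : C) :=
  forall S T : ideal (aquot_type (nilradical C)),
    simple_alg (subalg_type (subalg_of_ideal S)) ->
    (S + T = fullv)%VS -> (S :&: T = 0)%VS ->
    daddv_pi S T (qpi (nilradical C) e) = 0 <->
    daddv_pi S T (qpi (nilradical C) f) = 0.

Definition strict_orthogonal_idempotent_pair
    (F : fieldType) (C : assocAlgType F) (e f : C) : Prop :=
  [/\ idempotent_pair e f, orthogonal_pair e f & strict_pair e f].

(* Main.v *)
(* If R is the radical of A', strictness says that e' and f' generate the     *)
(* same ideal of A' / R, because in a semisimple algebra every ideal has an   *)
(* identity and hence is a direct factor.  An idempotent in J + R lies in the *)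
(* ideal J since R is nilpotent, so e' and f' already generate the same ideal *)
(* of A'.  This property passes to every algebra containing A', and it makes  *)
(* (e', f') strict there: the pair (e, f) = (e', f') works.                   *)
Require Import Defs.
From mathcomp Require Import all_boot all_order all_algebra.
From mathcomp Require Import boolp.

Set Implicit Arguments.
Unset Strict Implicit.
Unset Printing Implicit Defensive.

Import GRing.Theory.
Local Open Scope ring_scope.

(** Simple components of [A'] modulo its radical need not match those of [A], but ideal membership
    transfers. By [strict_pair_mem_ideal], an ideal of [A'] containing one of [e'], [f'] contains
    the other; ideals of the quotient of [A] by its radical pull back to ideals of [A'], whence
    [strict_pair_subalg]. The structure theory behind this starts from
    [quotient_nilradical_semiprime]: minimal right ideals yield idempotents, so every ideal has an
    identity ([ideal_unit]) and a complementary ideal ([ideal_complement]), and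
    [mem_ideal_of_components] turns the condition on components into one on ideals. *)

Section Subspaces.

Context {F : fieldType} {V : vectType F}.
Implicit Types U W : {vspace V}.

Lemma minimal_vspace (P : {vspace V} -> Prop) :
  (exists U, P U) ->
  exists2 U, P U & forall W, P W -> (W <= U)%VS -> W = U.
Proof.
case=> U0 PU0.
have exd : exists n, `[< exists2 U, P U & \dim U = n >].
  by exists (\dim U0); apply/asboolP; exists U0.
case: (ex_minnP exd) => n /asboolP[U PU dU] minn.
exists U => // W PW sWU; apply/eqP; rewrite eqEdim sWU dU.
by apply: minn; apply/asboolP; exists W.
Qed.

(** Comprehension for subspaces: a subspace inside [P] is enlarged by vectors of [P] until it
    exhausts [P]; [n] bounds its codimension. *)
Lemma vspace_of_pred (P : V -> Prop) :
  P 0 -> (forall k x y, P x -> P y -> P (k *: x + y)) ->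
  exists U, forall x, x \in U <-> P x.
Proof.
move=> P0 Plin.
suff grow n U : (forall x, x \in U -> P x) -> (\dim {:V} <= \dim U + n)%N ->
    exists U', forall x, x \in U' <-> P x.
  apply: (grow (\dim {:V}) 0%VS); last exact: leq_addl.
  by move=> x; rewrite memv0 => /eqP->.
elim: n U => [|n IHn] U sUP leU.
all: have [maxU|] := pselect (forall x, P x -> x \in U);
  first by exists U => x; split=> [/sUP|/maxU].
  case=> x _; suff -> : U = fullv by apply: memvf.
  by apply/eqP; rewrite eqEdim subvf -[leqRHS]addn0.
move=> /existsNP[x /not_implyP[Px /negP nUx]].
apply: (IHn (<[x]> + U)%VS).
  by move=> _ /memv_addP[_ /vlineP[k ->] [u /sUP Pu ->]]; apply: Plin.
apply: leq_trans leU _; rewrite addnS -addSn leq_add2r.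
rewrite ltn_neqAle dimvS ?addvSr // andbT.
apply: contraNneq nUx => eqd.
have /eqP -> : U == (<[x]> + U)%VS by rewrite eqEdim addvSr eqd leqnn.
by rewrite (subvP (addvSl _ _)) // memv_line.
Qed.

Lemma daddv_pi_eq0 U W x :
  (U + W = fullv)%VS -> (U :&: W = 0)%VS ->
  daddv_pi U W x = 0 <-> x \in W.
Proof.
move=> UWf UW0.
have := daddv_pi_add UW0 (_ : x \in (U + W)%VS); rewrite UWf memvf => /(_ isT).
move=> defx; split=> [x0 | Wx]; first by rewrite -defx x0 add0r memv_pi.
have WU0 : (W :&: U = 0)%VS by rewrite capvC.
by apply: (addIr x); rewrite add0r -{2}(daddv_pi_id WU0 Wx).
Qed.

End Subspaces.

(** * Ideals and their products *)

Section Products.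

Context {F : fieldType} {B : assocAlgType F}.
Implicit Types (b u x y : B) (I J K L T : {vspace B}).

Lemma amul0l x : (0 * x)%g = 0 :> B.
Proof. by have := amulZl 0 x x; rewrite !scale0r. Qed.

Lemma amulBl x y b : ((x - y) * b)%g = (x * b)%g - (y * b)%g.
Proof. by rewrite amulDl -!scaleN1r amulZl. Qed.

Lemma amulBr b x y : (b * (x - y))%g = (b * x)%g - (b * y)%g.
Proof. by rewrite amulDr -!scaleN1r amulZr. Qed.

Definition right_ideal L := forall x y, x \in L -> (x * y)%g \in L.

Lemma ideal_predMl I x y : ideal_pred I -> y \in I -> (x * y)%g \in I.
Proof. by move=> /ideal_predP idI /(idI x)[]. Qed.

Lemma ideal_predMr I x y : ideal_pred I -> x \in I -> (x * y)%g \in I.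
Proof. by move=> /ideal_predP idI /(idI y)[]. Qed.

Lemma ideal_cap I J : ideal_pred I -> ideal_pred J -> ideal_pred (I :&: J)%VS.
Proof.
move=> idI idJ; apply/ideal_predP=> x y /memv_capP[Iy Jy].
by rewrite !memv_cap (ideal_predMl x idI Iy) (ideal_predMl x idJ Jy)
           (ideal_predMr x idI Iy) (ideal_predMr x idJ Jy).
Qed.

Lemma ideal_mul_cap0 I J x y : ideal_pred I -> ideal_pred J ->
  (I :&: J = 0)%VS -> x \in I -> y \in J -> (x * y)%g = 0.
Proof.
move=> idI idJ IJ0 Ix Jy; apply/eqP; rewrite -memv0 -IJ0 memv_cap.
by rewrite ideal_predMr ?ideal_predMl.
Qed.

(** In finite dimension this says that the nilpotent radical is zero; it is the form of
    semisimplicity used below. *)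
Definition semiprime := forall I, ideal_pred I ->
  {in I & I, forall x y, (x * y)%g = 0} -> I = 0%VS.

End Products.

(** * Structure of semiprime algebras: idempotents, identities and complements of ideals *)

Section Semiprime.

Context {F : fieldType} {B : assocAlgType F}.
Implicit Types (b u x y : B) (I J K L T : {vspace B}).
Hypothesis spB : @semiprime F B.

(* The right annihilator N of L and the left annihilator M of N inside N are  *)
(* two-sided, and L <= M with M M = 0.                                        *)
Lemma semiprime_right_ideal L : right_ideal L ->
  {in L & L, forall x y, (x * y)%g = 0} -> L = 0%VS.
Proof.
move=> rL L2.
have [N defN] : exists N : {vspace B},
    forall z, z \in N <-> {in L, forall x, (x * z)%g = 0}.
  apply: vspace_of_pred => [x _|k y z y0 z0 x Lx]; first exact: amul0.
  by rewrite amulDr amulZr y0 ?z0 // scaler0 addr0.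
have [M defM] : exists M : {vspace B},
    forall z, z \in M <-> z \in N /\ {in N, forall y, (z * y)%g = 0}.
  apply: vspace_of_pred => [|k x z [Nx x0] [Nz z0]].
    by split=> [|y _]; rewrite ?mem0v ?amul0l.
  split=> [|y Ny]; first by rewrite memvD ?memvZ.
  by rewrite amulDl amulZl x0 ?z0 // scaler0 addr0.
have NM b z : z \in N -> (b * z)%g \in N /\ (z * b)%g \in N.
  move=> /defN Nz; split; apply/defN=> x Lx; rewrite mulgA; last first.
    by rewrite Nz ?amul0l.
  by rewrite Nz ?rL.
have M0 : M = 0%VS.
  apply: spB => [|x y /defM[_ x0] /defM[Ny _]]; last exact: x0.
  apply/ideal_predP=> b z /defM[Nz z0]; have [Nbz Nzb] := NM b z Nz.
  split; apply/defM; split=> // y Ny; rewrite -mulgA ?z0 ?amul0 //.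
  by case: (NM b y Ny).
apply/eqP; rewrite -subv0 -M0; apply/subvP=> x Lx; apply/defM; split.
  by apply/defN=> y Ly; apply: L2.
by move=> y /defN; apply.
Qed.

(** Brauer's argument: in a minimal right ideal [L0] choose [x] with [x L0 != 0]. Then [x L0 = L0]
    gives [x = x v], and left multiplication by [x] is injective on [L0] and kills [v v - v]. *)
Lemma right_ideal_idempotent L : right_ideal L -> L != 0%VS ->
  exists2 v, v \in L & (v * v)%g = v /\ v != 0.
Proof.
move=> rL Ln0.
have [|L0 [rL0 L0n0 sL0L] minL0] := minimal_vspace
    (P := fun K => [/\ right_ideal K, K != 0%VS & (K <= L)%VS]).
  by exists L; split.
have [x [y [L0x L0y xy0]]] :
    exists x y, [/\ x \in L0, y \in L0 & (x * y)%g != 0].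
  apply: contrapT => no; case/eqP: L0n0; apply: semiprime_right_ideal => //.
  move=> x y L0x L0y; apply/eqP; apply: contraT => xy0.
  by case: no; exists x, y.
have sub0 K : right_ideal K -> (K <= L0)%VS -> K != 0%VS -> K = L0.
  by move=> rK sK Kn0; apply: minL0 => //; split=> //; apply: subv_trans sL0L.
have [xL defxL] : exists xL : {vspace B},
    forall z, z \in xL <-> exists2 l, l \in L0 & z = (x * l)%g.
  apply: vspace_of_pred => [|k _ _ [l Ll ->] [m Lm ->]].
    by exists 0; rewrite ?mem0v ?amul0.
  by exists (k *: l + m); rewrite ?amulDr ?amulZr // memvD ?memvZ.
have xLE : xL = L0.
  apply: sub0.
  - move=> _ b /defxL[l Ll ->]; apply/defxL; exists (l * b)%g; first exact: rL0.
    by rewrite mulgA.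
  - by apply/subvP=> _ /defxL[l _ ->]; apply: rL0.
  - apply: contraNneq xy0 => xL0; rewrite -memv0 -xL0.
    by apply/defxL; exists y.
have [v L0v xv] : exists2 v, v \in L0 & x = (x * v)%g.
  by apply/defxL; rewrite xLE.
have [K defK] : exists K : {vspace B},
    forall z, z \in K <-> z \in L0 /\ (x * z)%g = 0.
  apply: vspace_of_pred => [|k z t [Lz xz] [Lt xt]].
    by rewrite mem0v amul0.
  by rewrite memvD ?memvZ // amulDr amulZr xz xt scaler0 addr0.
have K0 : K = 0%VS.
  apply: contrapT => /eqP Kn0; case/eqP: (xy0).
  suff /defK[] : y \in K by [].
  rewrite (sub0 K) //; last by apply/subvP=> z /defK[].
  by move=> z b /defK[Lz xz]; apply/defK; rewrite mulgA xz amul0l rL0.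
exists v; first exact: (subvP sL0L).
split; last by apply: contraNneq xy0 => v0; rewrite xv v0 amul0 amul0l.
apply/eqP; rewrite -subr_eq0 -memv0 -K0; apply/defK.
by rewrite memvB ?rL0 // amulBr mulgA -!xv subrr.
Qed.

(** Choose an idempotent [u] of [K] whose right annihilator [L] in [K] is minimal. It contains every
    [x - u x], and it is zero because an idempotent in it would allow [u] to be improved. *)
Lemma ideal_left_unit K : ideal_pred K ->
  exists2 u, u \in K & {in K, forall x, (u * x)%g = x}.
Proof.
move=> idK.
have [|L [u [Ku uu defL]] minL] := minimal_vspace (P := fun L => exists u,
    [/\ u \in K, (u * u)%g = u
       & forall x, x \in L <-> x \in K /\ (u * x)%g = 0]).
  (* The idempotent 0, with annihilator all of [K], shows that there are candidates. *)
  exists K, 0; split; rewrite ?mem0v ?amul0 // => x.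
  by rewrite amul0l; split=> [|[]].
exists u => // x Kx; apply/eqP; rewrite -subr_eq0 -oppr_eq0 opprB -memv0.
suff <- : L = 0%VS.
  by apply/defL; rewrite memvB ?ideal_predMr // amulBr mulgA uu subrr.
apply: contrapT => /eqP Ln0.
have rL : right_ideal L.
  move=> y b /defL[Ky uy]; apply/defL.
  by rewrite mulgA uy amul0l ideal_predMr.
have [v Lv [vv vn0]] := right_ideal_idempotent rL Ln0.
have [Kv uv] := (defL v).1 Lv.
(* w is an idempotent of K with a smaller right annihilator than u, since    *)
(* u w = u and w v = v.                                                       *)
pose w := u + v - (v * u)%g.
have wv : (w * v)%g = v.
  by rewrite /w amulBl amulDl uv vv -mulgA uv amul0 add0r subr0.
have uw : (u * w)%g = u.
  by rewrite /w amulBr amulDr uu uv mulgA uv amul0l addr0 subr0.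
have ww : (w * w)%g = w.
  rewrite {2}/w amulBr amulDr mulgA wv {1}/w amulBl amulDl uu -mulgA uu.
  by rewrite addrK.
have [M defM] : exists M : {vspace B},
    forall z, z \in M <-> z \in K /\ (w * z)%g = 0.
  apply: vspace_of_pred => [|k z t [Kz wz] [Kt wt]].
    by rewrite mem0v amul0.
  by rewrite memvD ?memvZ // amulDr amulZr wz wt scaler0 addr0.
have ML : M = L.
  apply: minL.
    by exists w; split; rewrite // /w memvB ?memvD // ideal_predMr.
  apply/subvP=> z /defM[Kz wz]; apply/defL; split=> //.
  by rewrite -uw -mulgA wz amul0.
by case/eqP: vn0; rewrite -wv; suff /defM[] : v \in M by []; rewrite ML.
Qed.

(** The left annihilator of [K] in [K] is an ideal of square zero containing every [x u - x], so [u]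
    is also a right identity. Then [b u = u b u = u b] for every [b]. *)
Lemma ideal_unit K : ideal_pred K ->
  exists2 u, u \in K &
    {in K, forall x, (u * x)%g = x} /\ forall b, (b * u)%g = (u * b)%g.
Proof.
move=> idK; have [u Ku ux] := ideal_left_unit idK; exists u => //; split=> //.
have [N defN] : exists N : {vspace B},
    forall z, z \in N <-> z \in K /\ {in K, forall x, (z * x)%g = 0}.
  apply: vspace_of_pred => [|k z t [Kz z0] [Kt t0]].
    by split=> [|y _]; rewrite ?mem0v ?amul0l.
  split=> [|y Ky]; first by rewrite memvD ?memvZ.
  by rewrite amulDl amulZl z0 ?t0 // scaler0 addr0.
have N0 : N = 0%VS.
  apply: spB => [|x y /defN[_ x0] /defN[Ky _]]; last exact: x0.
  apply/ideal_predP=> b z /defN[Kz z0].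
  split; apply/defN; split=> [|y Ky].
  - exact: ideal_predMl.
  - by rewrite -mulgA z0 ?amul0.
  - exact: ideal_predMr.
  - by rewrite -mulgA z0 ?ideal_predMl.
have xu x : x \in K -> (x * u)%g = x.
  move=> Kx; apply/eqP; rewrite -subr_eq0 -memv0 -N0; apply/defN.
  rewrite memvB ?ideal_predMr //; split=> // y Ky.
  by rewrite amulBl -mulgA ux ?subrr.
move=> b; rewrite -[LHS]ux ?ideal_predMl // mulgA.
by rewrite xu // ideal_predMr.
Qed.

(** Peirce decomposition [b = u b + (b - u b)] for the central identity [u] of [K]. *)
Lemma ideal_complement K : ideal_pred K ->
  exists2 T, ideal_pred T & (K + T = fullv)%VS /\ (K :&: T = 0)%VS.
Proof.
move=> idK; have [u Ku [ux uC]] := ideal_unit idK.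
have [T defT] : exists T : {vspace B}, forall z, z \in T <-> (u * z)%g = 0.
  apply: vspace_of_pred => [|k z t uz ut]; first exact: amul0.
  by rewrite amulDr amulZr uz ut scaler0 addr0.
exists T.
  apply/ideal_predP=> b z /defT uz; split; apply/defT.
    by rewrite mulgA -uC -mulgA uz amul0.
  by rewrite mulgA uz amul0l.
split; apply/eqP.
  rewrite eqEsubv subvf; apply/subvP=> b _.
  rewrite -[b](subrK (u * b)%g) addrC memv_add ?ideal_predMr //.
  by apply/defT; rewrite amulBr mulgA (ux u Ku) subrr.
rewrite -subv0; apply/subvP=> x /memv_capP[Kx /defT].
by rewrite ux // => ->; rewrite mem0v.
Qed.

Lemma minimal_ideal_simple (S : ideal B) : (S : {vspace B}) != 0%VS ->
  (forall I, ideal_pred I -> (I <= S)%VS -> I = 0%VS \/ I = S) ->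
  simple_alg (subalg_type (subalg_of_ideal S)).
Proof.
move=> Sn0 minS; have idS := idealP S.
have [u Su [ux uC]] := ideal_unit idS.
split.
  move=> SS0; case/eqP: Sn0; apply: spB => // x y Sx Sy.
  pose x1 : subalg_type (subalg_of_ideal S) := Subvs Sx.
  pose y1 : subalg_type (subalg_of_ideal S) := Subvs Sy.
  have : (x1 * y1)%g \in aprodv fullv fullv by rewrite memv_aprod ?memvf.
  by rewrite SS0 memv0 => /eqP/(congr1 vsval).
move=> I; have idI := idealP I.
have [J defJ] : exists J : {vspace B},
    forall z, z \in J <-> exists2 i, i \in (I : {vspace _}) & z = vsval i.
  apply: vspace_of_pred => [|k _ _ [i Ii ->] [j Ij ->]].
    by exists 0; rewrite ?mem0v ?linear0.
  by exists (k *: i + j); rewrite ?linearP // memvD ?memvZ.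
(* b i = (b u) i for i in S, so ideals of S are ideals of B.                  *)
have idJ : ideal_pred J.
  apply/ideal_predP=> b _ /defJ[i Ii ->].
  have Si : vsval i \in (S : {vspace B}) := subvsP i.
  have Sbu : (b * u)%g \in (S : {vspace B}) by apply: ideal_predMl.
  pose c : subalg_type (subalg_of_ideal S) := Subvs Sbu.
  split; apply/defJ.
    exists (c * i)%g; first exact: ideal_predMl.
    by rewrite -[vsval i in LHS]ux // mulgA.
  exists (i * c)%g; first exact: ideal_predMr.
  rewrite /= uC mulgA; congr (_ * _)%g.
  by rewrite uC ux.
have sJS : (J <= S)%VS by apply/subvP=> _ /defJ[i _ ->]; apply: subvsP.
case: (minS J idJ sJS) => EJ; [left | right]; apply/eqP.
  rewrite -subv0; apply/subvP=> i Ii; rewrite memv0; apply/eqP/val_inj.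
  apply/eqP; rewrite /= -memv0 -EJ; apply/defJ; by exists i.
rewrite eqEsubv subvf; apply/subvP=> i _.
have : vsval i \in J by rewrite EJ; apply: subvsP.
by case/defJ=> j Ij /val_inj->.
Qed.

(** Split the algebra as [J + N]. If [e] had a nonzero part in [N], some simple component inside [N]
    would not annihilate [e], although it annihilates [f], which lies in [J]. *)
Lemma mem_ideal_of_components e f : (e * e)%g = e ->
    (forall S T : ideal B, simple_alg (subalg_type (subalg_of_ideal S)) ->
      (S + T = fullv)%VS -> (S :&: T = 0)%VS ->
      f \in (T : {vspace B}) -> e \in (T : {vspace B})) ->
  forall J, ideal_pred J -> f \in J -> e \in J.
Proof.
move=> ee comp J idJ Jf.
have [N idN [JNf JN0]] := ideal_complement idJ.
have : e \in (J + N)%VS by rewrite JNf memvf.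
case/memv_addP=> j Jj [n Nn defe].
have [n0 | nn0] := eqVneq n 0; first by rewrite defe n0 addr0.
exfalso.
(* N e contains n e = n != 0; the complement T of a minimal S as in P         *)
(* contains f but not e.                                                      *)
pose P S :=
  [/\ ideal_pred S, (S <= N)%VS & exists2 s, s \in S & (s * e)%g != 0].
have [|S [idS sSN [s Ss se]] minS] := minimal_vspace (P := P).
  exists N; split=> //; exists n => //.
  suff -> : (n * e)%g = n by [].
  (* Expanding [e e = e] with [e = j + n] puts [n e - n] in both [N] and [J], hence makes it
     zero. *)
  have En : (n * e)%g - n = j - (j * e)%g.
    apply/eqP; rewrite subr_eq addrAC -defe eq_sym subr_eq.
    by rewrite [X in _ == X]addrC -amulDl -defe ee.
  apply/eqP; rewrite -subr_eq0 -memv0 -JN0 memv_cap {1}En.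
  by rewrite !memvB // ideal_predMr.
pose S0 := Ideal idS.
have [T idT [STf ST0]] := ideal_complement idS.
pose T0 := Ideal idT.
have Tf : f \in T.
  have : f \in (S + T)%VS by rewrite STf memvf.
  case/memv_addP=> x Sx [y Ty deff].
  suff x0 : x = 0 by rewrite deff x0 add0r.
  have [u Su [ux uC]] := ideal_unit idS.
  have <- : (u * f)%g = x.
    by rewrite deff amulDr ux // (ideal_mul_cap0 idS idT ST0 Su Ty) addr0.
  by apply: (ideal_mul_cap0 idN idJ) => //; [rewrite capvC | apply: (subvP sSN)].
case/eqP: (se); apply: (ideal_mul_cap0 idS idT ST0 Ss).
apply: (comp S0 T0) => //; apply: minimal_ideal_simple => [|I idI sIS].
  apply: contraTneq se => /= S0E; move: Ss; rewrite S0E memv0 => /eqP->.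
  by rewrite amul0l eqxx.
(* If [I e = 0], removing from [s] its part in [I] shows that [S :&: I'] still satisfies [P];
   minimality gives [S <= I'], so [I] lies in [I :&: I' = 0]. *)
have [PI | nPI] := pselect (P I); first by right; apply: minS.
left; have [I' idI' [IIf II0]] := ideal_complement idI.
have Ie x : x \in I -> (x * e)%g = 0.
  move=> Ix; apply/eqP; apply: contraT => xe.
  by case: nPI; split=> //; [apply: subv_trans sSN | exists x].
have : s \in (I + I')%VS by rewrite IIf memvf.
case/memv_addP=> x Ix [y I'y defs].
have PSI : P (S :&: I')%VS.
  split; [exact: ideal_cap | exact: subv_trans (capvSl _ _) sSN |].
  exists y; last first.
    by have <- : (s * e)%g = (y * e)%g by rewrite defs amulDl (Ie x Ix) add0r.
  by rewrite memv_cap I'y -(addKr x y) -defs addrC memvB // (subvP sIS).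
have SI : (S <= I')%VS by rewrite -(minS _ PSI (capvSl _ _)) capvSr.
apply/eqP; rewrite -subv0 -II0 subv_cap subvv.
exact: subv_trans sIS SI.
Qed.

End Semiprime.

(** * Passage between an algebra and its quotient by the nilpotent radical *)

Section Radical.

Context {F : fieldType} {C : assocAlgType F}.
Let R : ideal C := nilradical C.
Let Q := aquot_type R.

(** The preimage [P] of a square-zero ideal has [P P] inside [R], so it is nilpotent and therefore
    inside [R]. *)
Lemma quotient_nilradical_semiprime : @semiprime F Q.
Proof.
move=> I idI I2.
have [P defP] : exists P : {vspace C}, forall x, x \in P <-> qpi R x \in I.
  apply: vspace_of_pred => [|k x y Ix Iy]; first by rewrite linear0 mem0v.
  by rewrite linearP memvD ?memvZ.
have idP' : ideal_pred P.
  apply/ideal_predP=> x y /defP Iy; split; apply/defP; rewrite qpiM.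
    exact: ideal_predMl.
  exact: ideal_predMr.
have [_ [m Rm] maxR] := nilradical_vsP C.
have sP : (P <= R)%VS.
  (* As [apowv] is shifted by one, this index is the power [2(m+1)] of [P], contained in the power
     [m+1] of [R], which is zero. *)
  apply: maxR => //; exists (m.*2.+1).
  apply/eqP; rewrite -subv0 -Rm.
  have PP : (aprodv P P <= R)%VS.
    apply/aprodvP=> x y /defP Ix /defP Iy.
    by rewrite -qpi_eq0 qpiM I2.
  elim: m {Rm} => [|m IHm]; first exact: PP.
  apply: subv_trans (aprodvA_sub _ _ _) _.
  exact: aprodvS PP IHm.
apply/eqP; rewrite -subv0; apply/subvP=> q.
have [x ->] := qpi_surj q; move/defP => /(subvP sP).
by rewrite memv0 qpi_eq0.
Qed.

Lemma mem_ideal_mod_nilradical e (J : {vspace C}) : ideal_pred J ->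
  (e * e)%g = e -> e \in (J + R)%VS -> e \in J.
Proof.
move=> idJ ee JRe; have [_ [m Rm] _] := nilradical_vsP C.
(* Induction shows that [e] lies in [J] plus each power of [R]: multiply [e = j + r] by [e = i + s],
   where only [r s] can leave [J]. *)
rewrite -[J]addv0 -Rm; elim: m {Rm} => // m IHm.
case/memv_addP: JRe => j Jj [r Rr defe].
case/memv_addP: IHm => i Ji [s Rs defe'].
have -> : e = ((j * e)%g + (r * i)%g) + (r * s)%g.
  by rewrite -addrA -amulDr -defe' -amulDl -defe ee.
apply: memv_add; last exact: memv_aprod.
exact: memvD (ideal_predMr e idJ Jj) (ideal_predMl r idJ Ji).
Qed.

(** The image [K] of [J] in the quotient contains the class of [e] by the argument on components;
    this puts [e] in [J + R], and idempotence removes [R]. *)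
Lemma strict_pair_mem_ideal (e f : C) : (e * e)%g = e -> strict_pair e f ->
  forall J : {vspace C}, ideal_pred J -> f \in J -> e \in J.
Proof.
move=> ee strict J idJ Jf.
apply: mem_ideal_mod_nilradical => //.
have [K defK] : exists K : {vspace Q},
    forall q, q \in K <-> exists2 x, x \in J & q = qpi R x.
  apply: vspace_of_pred => [|k _ _ [x Jx ->] [y Jy ->]].
    by exists 0; rewrite ?mem0v ?linear0.
  by exists (k *: x + y); rewrite ?linearP // memvD ?memvZ.
suff /defK[x Jx /eqP] : qpi R e \in K.
  rewrite -subr_eq0 -linearB qpi_eq0 => Rex.
  by rewrite -(subrK x e) addrC memv_add.
apply: (mem_ideal_of_components quotient_nilradical_semiprime (f := qpi R f)).
- by rewrite -qpiM ee.
- move=> S T simS STf ST0 /(daddv_pi_eq0 _ STf ST0) f0.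
  exact/(daddv_pi_eq0 _ STf ST0)/strict.
- apply/ideal_predP=> q _ /defK[x Jx ->]; have [y ->] := qpi_surj q.
  split; apply/defK; rewrite -qpiM.
    by exists (y * x)%g => //; apply: ideal_predMl.
  by exists (x * y)%g => //; apply: ideal_predMr.
- by apply/defK; exists f.
Qed.

Lemma strict_pairC (e f : C) : strict_pair e f -> strict_pair f e.
Proof. by move=> strict S T simS ST ST0; split=> /strict; apply. Qed.

End Radical.

(** * Transfer of strictness from a subalgebra to the whole algebra *)

Lemma strict_pair_subalg (F : fieldType) (A : assocAlgType F)
    (A' : subalgebra A) (e f : subalg_type A') :
  idempotent_pair e f -> strict_pair e f ->
  strict_pair (subalg_val e) (subalg_val f).
Proof.
case=> ee ff strict S T simS STf ST0.
(* The projection along [T] vanishes exactly on [T], so strictness in [A] asks whether the pullback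
   [J] of [T] to [A'] contains both [e] and [f] or neither. *)
have [J defJ] : exists J : {vspace subalg_type A'}, forall x,
    x \in J <-> qpi (nilradical A) (subalg_val x) \in (T : {vspace _}).
  apply: vspace_of_pred => [|k x y Tx Ty]; first by rewrite !linear0 mem0v.
  by rewrite /subalg_val !linearP memvD ?memvZ.
have idJ : ideal_pred J.
  apply/ideal_predP=> x y /defJ Ty; split; apply/defJ.
    by rewrite subalg_valM qpiM ideal_mull.
  by rewrite subalg_valM qpiM ideal_mulr.
split=> /(daddv_pi_eq0 _ STf ST0)/defJ J1; apply/(daddv_pi_eq0 _ STf ST0)/defJ.
  exact: strict_pair_mem_ideal ff (strict_pairC strict) _ idJ J1.
exact: strict_pair_mem_ideal ee strict _ idJ J1.
Qed.

Theorem corollary1p3 (F : closedFieldType) (A : assocAlgType F)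
    (A' : subalgebra A) (e' f' : subalg_type A') :
  one_perfect A ->
  perfect (subalg_type A') ->
  strict_orthogonal_idempotent_pair e' f' ->
  exists e f : A, strict_orthogonal_idempotent_pair e f /\
    forall a' : subalg_type A', exists a : A,
      subalg_val (e' * a' * f')%g = (e * a * f)%g.
Proof.
move=> _ _ [idem [ef fe] strict]; have [ee ff] := idem.
exists (subalg_val e'), (subalg_val f'); split; last first.
  by move=> a'; exists (subalg_val a').
split; last exact: strict_pair_subalg idem strict.
  by split; rewrite -subalg_valM ?ee ?ff.
by split; rewrite -subalg_valM ?ef ?fe.
Qed.
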